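(* Let $\mathbf P=(P,\leq,0,1)$ be a bounded poset satisfying the Ascending Chain Condition, let $a,b,c\in P$ and let $A,B$ be non-empty subsets of $P$. Then the following hold: (i) $a\rightarrow b$ is an antichain. (ii) $b\leq_1a\rightarrow b$. (iii) $a\leq_1(a\rightarrow b)\rightarrow b$. (iv) $a\leq b$ implies $c\rightarrow a\leq_1c\rightarrow b$ and $b\rightarrow c\leq_1a\rightarrow c$. (v) $\Lambda(a,a\rightarrow b)=L(a,b)$. (vi) $\Lambda(a\rightarrow b,b)=_1b$. (vii) $1\rightarrow A=A$; especially $1\rightarrow a=a$. (viii) $A\rightarrow B=1$ if and only if $A\leq_1B$; especially $a\rightarrow b=1$ if and only if $a\leq b$. (ix) $A\odot b\leq c$ if and only if $A\leq_1b\rightarrow c$. (x) $a\odot(a\rightarrow b)=a\odot b$.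
   Context: A poset is bounded if it has a bottom element $0$ and a top element $1$. The Ascending Chain Condition (ACC) says that there is no infinite strictly ascending chain. Singletons are identified with their unique element, i.e. $x$ is written for $\{x\}$. For $a,b\in P$ and non-empty subsets $A,B\subseteq P$: $\operatorname{Max}A$ is the set of all maximal elements of $A$; $L(a,b):=\{x\in P\mid x\leq a\text{ and }x\leq b\}$; $\Lambda(A,B):=\bigcup_{x\in A,\,y\in B}L(x,y)$; $A\leq B$ means $x\leq y$ for all $x\in A$ and all $y\in B$; $A\leq_1B$ means that for every $x\in A$ there exists $y\in B$ with $x\leq y$; $A=_1B$ means that both $A\leq_1B$ and $B\leq_1A$. For $a,b\in P$ and non-empty subsets $A,B$ of $P$, the unsharp implication and conjunction are defined by $$a\rightarrow b:=\operatorname{Max}\{x\in P\mid L(a,x)\leq b\},\qquad A\rightarrow B:=\operatorname{Max}\{y\in P\mid L(x,y)\leq_1B\text{ for all }x\in A\},$$ $$a\odot b:=\operatorname{Max}L(a,b),\qquad A\odot B:=\operatorname{Max}\Lambda(A,B).$$ For singletons the set version and the element version agree. In expressions such as $b\leq_1 a\rightarrow b$ the relation $\leq_1$ binds weaker than $\rightarrow$.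
   Formalization: In (vii), 1→A=A fails for general non-empty A (e.g. A={0,1} with 0≠1 gives 1→A={1}); it is replaced by 1→A=Max A for every A, and 1→A=A for every antichain A; 1→a=a is kept. *)

(* Defs.v *)
From mathcomp Require Import all_boot all_order.
From mathcomp Require Import boolp classical_sets.

Set Implicit Arguments.
Unset Strict Implicit.
Unset Printing Implicit Defensive.

Import Order.TTheory.
Local Open Scope classical_set_scope.
Local Open Scope order_scope.

Section Poset.
Context {d : Order.disp_t} {P : porderType d}.
Implicit Types (a b x y : P) (A B : set P).

Definition acc : Prop := ~ exists f : nat -> P, forall n : nat, f n < f n.+1.

Definition antichain A : Prop := forall x y, A x -> A y -> x <= y -> x = y.

Definition Max A : set P := [set x | A x /\ forall y, A y -> x <= y -> y = x].

Definition L a b : set P := [set x | x <= a /\ x <= b].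

Definition Lambda A B : set P := \bigcup_(x in A) \bigcup_(y in B) L x y.

Definition le_set A B : Prop := forall x y, A x -> B y -> x <= y.

Definition le1 A B : Prop := forall x, A x -> exists2 y, B y & x <= y.

Definition eq1 A B : Prop := le1 A B /\ le1 B A.

(* Elements and sets are distinct types, so each operation comes in an element
   version and a set version (suffix S); an element x occurring where a set is
   expected is written [set x]. impE and odotE below show that the two versions
   agree on singletons. *)
Definition imp a b : set P := Max [set x | le_set (L a x) [set b]].

Definition impS A B : set P :=
  Max [set y | forall x, A x -> le1 (L x y) B].

Definition odot a b : set P := Max (L a b).

Definition odotS A B : set P := Max (Lambda A B).

Lemma impE a b : impS [set a] [set b] = imp a b.
Proof.
rewrite /impS /imp; congr Max; apply/seteqP; split=> y /=.
  by move=> h z _ zL ->; have [_ ->] := h a erefl z zL.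
by move=> h x -> z zL; exists b => //; apply: h.
Qed.

Lemma odotE a b : odotS [set a] [set b] = odot a b.
Proof. by rewrite /odotS /Lambda !bigcup_set1. Qed.

End Poset.

Arguments acc {d} P.

(* The identity 1 -> A = A cannot hold for every non-empty A: the left-hand side
   is a set of maximal elements, hence an antichain. *)
Lemma impS_top_neq (d : Order.disp_t) (P : tbPOrderType d) :
  (\bot : P) <> \top ->
  impS [set \top] [set (\bot : P); \top] <> [set (\bot : P); \top].
Proof.
move=> neq eqA; have [_ /(_ \top)] : impS [set \top] [set (\bot : P); \top] \bot.
  by rewrite eqA; left.
move=> h; apply: neq; apply/esym/h; last exact: le0x.
by move=> x _ z [_ zt]; exists \top => //; right.
Qed.

(* Main.v *)
(* By the ACC every element of a set lies below a maximal one, so each claim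
   involving [Max S] on the right of [le1] or on the left of [le_set] reduces to
   the same claim for [S]; those claims only unfold the definition of [L]. *)
Require Import Defs.
From mathcomp Require Import all_boot all_order.
From mathcomp Require Import boolp classical_sets.

Local Open Scope classical_set_scope.
Local Open Scope order_scope.

Import Order.TTheory.

Section PosetLemmas.
Set Implicit Arguments.
Unset Strict Implicit.
Context {d : Order.disp_t} {P : porderType d}.
Implicit Types (a b x y : P) (A B S : set P).

(** If no maximal element of [S] lay above [x], every element of [S] above [x] would have a strictly
    larger one in [S]; choosing successors repeatedly would give an infinite ascending chain. *)
Lemma acc_le1_Max S : acc P -> le1 S (Max S).
Proof.
move=> hP x Sx; apply: contrapT => noMax; apply: hP.
(* Packing the invariant into a subtype makes the chosen successor a total self-map, which can be
   iterated from [x]. *)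
pose T := {y : P | S y /\ x <= y}.
have /choice[f ltf] (t : T) : exists u : T, sval t < sval u.
  case: t => y [Sy xy] /=.
  apply: contrapT => nogt; apply: noMax; exists y => //; split=> // z Sz yz.
  apply/eqP; apply: contrapT => /negP zy; apply: nogt.
  by exists (exist _ z (conj Sz (le_trans xy yz))); rewrite /= lt_neqAle eq_sym zy.
pose x0 : T := exist _ x (conj Sx (lexx x)).
by exists (fun n => sval (iter n f x0)) => n; apply: ltf.
Qed.

Lemma antichain_Max S : antichain (Max S).
Proof. by move=> x y [_ mx] [Sy _] xy; rewrite (mx y Sy xy). Qed.

Lemma Max_antichain A : antichain A -> Max A = A.
Proof.
move=> anti; apply/seteqP; split=> [x []//|x Ax].
by split=> // y Ay xy; rewrite (anti x y Ax Ay xy).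
Qed.

Lemma antichain_set1 a : antichain [set a].
Proof. by move=> x y -> ->. Qed.

(** Serves [impS_top], where the set defining the implication is the down-set generated by [A]. *)
Lemma Max_downset A : Max [set x | exists2 y, A y & x <= y] = Max A.
Proof.
apply/seteqP; split=> x [].
  move=> [y Ay xy] mx.
  (* The element of [A] above [x] is itself in the down-set, so maximality of [x] forces
     equality. *)
  have yx : y = x by apply: mx xy; exists y.
  by rewrite -yx in mx *; split=> // z Az; apply: mx; exists z.
move=> Ax mx; split; first by exists x.
move=> y [z Az yz] xy; apply/le_anti; rewrite xy andbT.
by rewrite -(mx z Az (le_trans xy yz)).
Qed.

Lemma le_set_Max S c : acc P -> le_set (Max S) [set c] <-> le_set S [set c].
Proof.
move=> hP; split=> h x y.
  move=> Sx cy; have [z Mz xz] := acc_le1_Max hP Sx.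
  exact: le_trans xz (h z y Mz cy).
by move=> [Sx _]; apply: h.
Qed.

Lemma le1_imp a b : acc P -> le1 [set x | le_set (L a x) [set b]] (imp a b).
Proof. exact: acc_le1_Max. Qed.

(** Modus ponens, the form in which later proofs use membership in [imp a b]. *)
Lemma imp_le a b x z : imp a b x -> z <= a -> z <= x -> z <= b.
Proof. by move=> [h _] za zx; apply: (h z b). Qed.

Lemma le1_imp_self a b : acc P -> le1 [set b] (imp a b).
Proof. by move=> hP _ ->; apply: le1_imp => // z _ [_ zb] ->. Qed.

Lemma le1_imp_imp a b : acc P -> le1 [set a] (impS (imp a b) [set b]).
Proof.
move=> hP _ ->; apply: (acc_le1_Max hP) => x abx z [zx za].
by exists b => //; apply: imp_le abx za zx.
Qed.

Lemma le1_impr a b c : acc P -> a <= b -> le1 (imp c a) (imp c b).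
Proof.
move=> hP ab x cax; apply: le1_imp => // z _ [zc zx] ->.
exact: le_trans (imp_le cax zc zx) ab.
Qed.

Lemma le1_impl a b c : acc P -> a <= b -> le1 (imp b c) (imp a c).
Proof.
move=> hP ab x bcx; apply: le1_imp => // z _ [za zx] ->.
exact: imp_le bcx (le_trans za ab) zx.
Qed.

(** One inclusion is modus ponens. For the other, [b] lies below some [y] in [imp a b], so that
    [L a b] is contained in [L a y]. *)
Lemma Lambda_imp a b : acc P -> Lambda [set a] (imp a b) = L a b.
Proof.
move=> hP; apply/seteqP; split=> z.
  by move=> [_ -> [y aby [za zy]]]; split=> //; apply: imp_le aby za zy.
move=> [za zb]; have [y aby b_y] := @le1_imp_self a b hP b erefl.
by exists a => //; exists y => //; split=> //; apply: le_trans b_y.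
Qed.

Lemma Lambda_imp_self a b :
  acc P -> eq1 (Lambda (imp a b) [set b]) [set b].
Proof.
move=> hP; split=> [z [x _ [_ -> [_ zb]]]|_ ->]; first by exists b.
have [y aby b_y] := @le1_imp_self a b hP b erefl.
by exists b => //; exists y => //; exists b.
Qed.

Lemma odotS_le A b c :
  acc P -> le_set (odotS A [set b]) [set c] <-> le1 A (imp b c).
Proof.
move=> hP; split.
  move=> /(le_set_Max _ _ hP) h x Ax; apply: le1_imp => // z _ [zb zx] ->.
  by apply: h => //; exists x => //; exists b.
move=> h; apply/(le_set_Max _ _ hP) => z _ [x Ax [_ -> [zx zb]]] ->.
have [y bcy xy] := h x Ax; exact: imp_le bcy zb (le_trans zx xy).
Qed.

Lemma odotS_imp a b : acc P -> odotS [set a] (imp a b) = odot a b.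
Proof. by move=> hP; rewrite /odotS Lambda_imp. Qed.

End PosetLemmas.

Section TopPoset.
Set Implicit Arguments.
Unset Strict Implicit.
Context {d : Order.disp_t} {P : tPOrderType d}.
Implicit Types (a b : P) (A B S : set P).

Lemma Max_eq_top S : acc P -> Max S = [set \top] <-> S \top.
Proof.
move=> hP; split=> [MS|St]; first by have [] : Max S \top by rewrite MS.
apply/seteqP; split=> [x [_ mx]|_ ->]; first by rewrite -(mx \top St (lex1 x)).
by split=> // y _; rewrite le1x => /eqP.
Qed.

(** As [L \top y] is the principal down-set of [y], the defining condition on [y] says that [y] lies
    below an element of [A]. *)
Lemma impS_top A : impS [set \top] A = Max A.
Proof.
rewrite -Max_downset /impS; congr Max; apply/seteqP; split=> y /=.
  by move=> /(_ \top erefl y); apply; split=> //; apply: lex1.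
move=> [z Az yz] _ -> w [_ wy]; exists z => //; exact: le_trans yz.
Qed.

Lemma imp_top a : imp \top a = [set a].
Proof. by rewrite -impE impS_top Max_antichain //; apply: antichain_set1. Qed.

(** By [Max_eq_top] it suffices to test whether [\top] satisfies the defining condition, and
    [L x \top] has greatest element [x]. *)
Lemma impS_eq_top A B : acc P -> impS A B = [set \top] <-> le1 A B.
Proof.
move=> hP; rewrite /impS Max_eq_top //=; split=> h x Ax.
  by apply: (h x Ax); split=> //; apply: lex1.
move=> z [zx _]; have [y By xy] := h x Ax; exists y => //; exact: le_trans xy.
Qed.

Lemma imp_eq_top a b : acc P -> imp a b = [set \top] <-> a <= b.
Proof.
move=> hP; rewrite -impE impS_eq_top //; split=> [h|ab _ ->]; last by exists b.
by have [_ ->] := h a erefl.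
Qed.

End TopPoset.

(** In view of [impS_top_neq], item (vii) gives the value [Max A] for arbitrary [A] and the equality
    with [A] for antichains, singletons included. *)
Theorem theorem4p1 (d : Order.disp_t) (P : tbPOrderType d) (hP : acc P)
    (a b c : P) (A B : set P) (hA : A !=set0) (hB : B !=set0) :
  (* (i) *) antichain (imp a b) /\
  (* (ii) *) le1 [set b] (imp a b) /\
  (* (iii) *) le1 [set a] (impS (imp a b) [set b]) /\
  (* (iv) *) (a <= b ->
               le1 (imp c a) (imp c b) /\ le1 (imp b c) (imp a c)) /\
  (* (v) *) Lambda [set a] (imp a b) = L a b /\
  (* (vi) *) eq1 (Lambda (imp a b) [set b]) [set b] /\
  (* (vii) *) (impS [set \top] A = Max A /\
                (antichain A -> impS [set \top] A = A) /\
                imp \top a = [set a]) /\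
  (* (viii) *) ((impS A B = [set \top] <-> le1 A B) /\
                 (imp a b = [set \top] <-> a <= b)) /\
  (* (ix) *) (le_set (odotS A [set b]) [set c] <-> le1 A (imp b c)) /\
  (* (x) *) odotS [set a] (imp a b) = odot a b.
Proof.
split; first exact: antichain_Max.
split; first exact: le1_imp_self.
split; first exact: le1_imp_imp.
split; first by move=> ab; split; [apply: le1_impr | apply: le1_impl].
split; first exact: Lambda_imp.
split; first exact: Lambda_imp_self.
split.
  split; first exact: impS_top.
  by split; [rewrite impS_top; apply: Max_antichain | apply: imp_top].
split; first by split; [apply: impS_eq_top | apply: imp_eq_top].
by split; [apply: odotS_le | apply: odotS_imp].
Qed.
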